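(* For all integers $n\ge 0$ and $k\ge 1$ and all $x\in\mathbb{C}$, $$C_n^{(k)}(x)=B_n^{(n-k+1)}(1-x)=\sum_{l=0}^{n}\sum_{j=0}^{l}\ \sum_{j_1+\cdots+j_k=j}\binom{j}{j_1,\dots,j_k}\binom{l}{j}S_1(n,l)\frac{(-x)^{l-j}}{(j_1+1)\cdots(j_k+1)},$$ where the innermost sum runs over $k$-tuples of nonnegative integers $(j_1,\dots,j_k)$ with sum $j$.
   Context: $(x)_n = x(x-1)\cdots(x-n+1)$ denotes the falling factorial, with $(x)_0=1$. For integers $k\ge1$, $n\ge0$, the higher-order Cauchy polynomials of the first kind (of order $k$) are $$C_n^{(k)}(x)=\int_0^1\cdots\int_0^1 (x_1+\cdots+x_k-x)_n\,dx_1\cdots dx_k.$$ $S_1(n,l)$ are the signed Stirling numbers of the first kind, defined by $(x)_n=\sum_{l=0}^n S_1(n,l)x^l$. $\binom{j}{j_1,\dots,j_k}=\frac{j!}{j_1!\cdots j_k!}$. For an integer $\alpha$ (possibly zero or negative), the Bernoulli polynomials $B_n^{(\alpha)}(x)$ of order $\alpha$ are defined by the formal power series identity $\left(\frac{t}{e^t-1}\right)^{\alpha}e^{xt}=\sum_{n=0}^\infty B_n^{(\alpha)}(x)\frac{t^n}{n!}$. Convention: $0^0=1$. *)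

(* Defs.v *)
From HB Require Import structures.
From mathcomp Require Import all_boot all_order all_algebra.
From mathcomp Require Import all_classical all_reals all_analysis.
From mathcomp Require Import complex.

Set Implicit Arguments.
Unset Strict Implicit.
Unset Printing Implicit Defensive.

Import Order.TTheory GRing.Theory Num.Theory.

Local Open Scope ring_scope.

Definition falling (A : nzRingType) (x : A) (n : nat) : A :=
  \prod_(i < n) (x - i%:R).

(* The coefficients of (X)_n in Z[X]; see [falling_stirling1]. *)
Definition stirling1 (n l : nat) : int := (falling ('X : {poly int}) n)`_l.

Lemma falling_morph (A B : nzRingType) (f : {rmorphism A -> B}) (x : A) n :
  f (falling x n) = falling (f x) n.
Proof.
rewrite /falling rmorph_prod; apply: eq_bigr => i _.
by rewrite rmorphB rmorph_nat.
Qed.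

Lemma size_falling n : size (falling ('X : {poly int}) n) = n.+1.
Proof.
rewrite /falling; under eq_bigr do rewrite -polyC_natr.
by rewrite size_prod_XsubC /index_enum -enumT size_enum_ord.
Qed.

Lemma falling_stirling1 (A : comNzRingType) (x : A) (n : nat) :
  falling x n = \sum_(l < n.+1) (stirling1 n l)%:~R * x ^+ l.
Proof.
have cx : commr_rmorph (intr : int -> A) x by move=> m; apply: mulrC.
have <- : horner_morph cx (falling 'X n) = falling x n.
  by rewrite (falling_morph (horner_morph cx)) /= horner_morphX.
rewrite /horner_morph (horner_coef_wide (n := n.+1)); last first.
  by rewrite (leq_trans (size_poly _ _)) // size_falling.
by apply: eq_bigr => l _; rewrite coef_map.
Qed.

(* The formal power series \sum_n f_n t^n is encoded by n |-> f_n. *)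
Section FormalPowerSeries.
Variable F : fieldType.
Implicit Types f g : nat -> F.

Definition fps_one : nat -> F := fun n => (n == 0)%:R.

Definition fps_mul f g : nat -> F :=
  fun n => \sum_(i < n.+1) f i * g (n - i)%N.

Definition fps_exp f (m : nat) : nat -> F := iter m (fps_mul f) fps_one.

(* The coefficients 0, ..., n of 1 / f, computed recursively from
   \sum_(i <= n) f_i (1 / f)_(n - i) = [n = 0]; see [fps_mulV]. *)
Fixpoint fps_inv_seq f (n : nat) : seq F :=
  if n is m.+1 then
    let s := fps_inv_seq f m in
    rcons s (- (f 0)^-1 * \sum_(i < m.+1) f i.+1 * s`_(m - i))
  else [:: (f 0)^-1].

Definition fps_inv f : nat -> F := fun n => (fps_inv_seq f n)`_n.

Definition fps_expz f (a : int) : nat -> F :=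
  match a with
  | Posz m => fps_exp f m
  | Negz m => fps_exp (fps_inv f) m.+1
  end.

(* e^(x t) *)
Definition fps_exponential (x : F) : nat -> F := fun n => x ^+ n / n`!%:R.

(* (e^t - 1) / t : the division by t is a shift of the coefficients, the
   constant coefficient of e^t - 1 being zero. *)
Definition fps_expm1_div : nat -> F :=
  fun n => fps_exponential 1 n.+1 - fps_one n.+1.

Definition bernoulli (a : int) (n : nat) (x : F) : F :=
  n`!%:R * fps_mul (fps_expz (fps_inv fps_expm1_div) a) (fps_exponential x) n.

Lemma size_fps_inv_seq f n : size (fps_inv_seq f n) = n.+1.
Proof. by elim: n => //= n IHn; rewrite size_rcons IHn. Qed.

Lemma nth_fps_inv_seq f n i : (i <= n)%N -> (fps_inv_seq f n)`_i = fps_inv f i.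
Proof.
elim: n => [|n IHn]; first by rewrite leqn0 => /eqP ->.
rewrite leq_eqVlt => /orP[/eqP -> //|lt_in] /=.
by rewrite nth_rcons size_fps_inv_seq lt_in IHn.
Qed.

Lemma fps_invS f n :
  fps_inv f n.+1 = - (f 0)^-1 * \sum_(i < n.+1) f i.+1 * fps_inv f (n - i)%N.
Proof.
rewrite {1}/fps_inv /= nth_rcons size_fps_inv_seq ltnn eqxx.
congr (_ * _); apply: eq_bigr => i _.
by rewrite nth_fps_inv_seq ?leq_subr.
Qed.

Lemma fps_mulV f : f 0 != 0 -> fps_mul f (fps_inv f) =1 fps_one.
Proof.
move=> f0 [|n]; rewrite /fps_mul big_ord_recl subn0.
  by rewrite big_ord0 addr0 divff.
rewrite fps_invS mulrA mulrN divff // mulN1r.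
by under [X in _ + X]eq_bigr do rewrite lift0 subSS; rewrite addNr.
Qed.

End FormalPowerSeries.

Section CauchyPolynomials.
Variable R : realType.

Definition integral01 (f : R -> R[i]) : R[i] :=
  Complex (\int[lebesgue_measure]_(t in `[0, 1]%classic) complex.Re (f t))
          (\int[lebesgue_measure]_(t in `[0, 1]%classic) complex.Im (f t)).

(* \int_0^1 ... \int_0^1 f [:: x_1; ...; x_k], with k integral signs *)
Fixpoint iter_integral01 (k : nat) (f : seq R -> R[i]) : R[i] :=
  if k is k'.+1 then
    integral01 (fun t => iter_integral01 k' (fun s => f (t :: s)))
  else f [::].

Definition cauchy_poly (k n : nat) (x : R[i]) : R[i] :=
  iter_integral01 k
    (fun s => falling (real_complex R (\sum_(t <- s) t) - x) n).

End CauchyPolynomials.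

Definition multinomial (F : fieldType) (k j : nat) (t : k.-tuple 'I_j.+1) : F :=
  j`!%:R / \prod_(i < k) (tnth t i)`!%:R.

(* Main.v *)
Require Import Defs.
From HB Require Import structures.
From mathcomp Require Import all_boot all_order all_algebra.
From mathcomp Require Import all_classical all_reals all_analysis.
From mathcomp Require Import complex ring.
Set Implicit Arguments.
Unset Strict Implicit.
Unset Printing Implicit Defensive.

Import Order.TTheory GRing.Theory Num.Theory.

Local Open Scope ring_scope.

(** Write e = (e^t - 1) / t and g = 1 / e = t / (e^t - 1). Integrating the series
    e^(y t) over y in a unit interval multiplies it by e. Hence, if a function
    of z is a linear combination of coefficients of h(t) e^(z t), its k-fold
    integral over the unit cube at z = y + x_1 + ... + x_k is the same
    combination of coefficients of h(t) e^k e^(y t)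
    ([iter_integral01_fps_exponential]).

    The falling factorial (z)_n has two such expressions. On the one hand it is
    n! times the n-th coefficient of g^(n+1) e^((1 + z) t), that is, the diagonal
    Bernoulli polynomial B_n^(n+1)(1 + z) ([falling_fps]): by the derivation
    t d/dt, going from n to n + 1 multiplies this coefficient by
    (z - n) / (n + 1) ([fps_exponential_diagonal]). On the other hand, the
    Stirling numbers expand (z)_n in the powers z^l, and z^l is l! times the l-th
    coefficient of e^(z t) ([falling_fps_stirling1]).

    Taking z = x_1 + ... + x_k - x and integrating, the first expression gives
    the coefficient of g^(n+1) e^k e^((1 - x) t), which is the Bernoulli
    polynomial of order n + 1 - k because e and g are inverse to each other.
    The second gives coefficients of e^k e^(- x t), and the multinomial sum is
    what the coefficients of e^k are when the power is multiplied out
    ([fpsX_expm1_div_tuple]). *)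

(** * The ring of formal power series *)

(** An alias of [nat -> F], so that multiplication is the Cauchy product and not
    the pointwise product that functions carry by default. *)
Definition fps (F : fieldType) := nat -> F.

Section FpsRing.
Variable F : fieldType.
Implicit Types f g h : fps F.

HB.instance Definition _ := gen_eqMixin (fps F).
HB.instance Definition _ := gen_choiceMixin (fps F).

Let addA : associative (fun f g : fps F => (fun n => f n + g n) : fps F).
Proof. by move=> f g h; apply/funext => n; rewrite addrA. Qed.
Let addC : commutative (fun f g : fps F => (fun n => f n + g n) : fps F).
Proof. by move=> f g; apply/funext => n; rewrite addrC. Qed.
Let add0 : left_id ((fun=> 0) : fps F)
  (fun f g : fps F => (fun n => f n + g n) : fps F).
Proof. by move=> f; apply/funext => n; rewrite add0r. Qed.
Let addN : left_inverse ((fun=> 0) : fps F)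
  (fun f : fps F => (fun n => - f n) : fps F)
  (fun f g : fps F => (fun n => f n + g n) : fps F).
Proof. by move=> f; apply/funext => n; rewrite addNr. Qed.

HB.instance Definition _ := GRing.isZmodule.Build (fps F) addA addC add0 addN.

(** The Cauchy product agrees with the product of polynomials as long as the
    truncation order exceeds the coefficient read off, so the ring axioms (and
    later the expansion of powers) are inherited from polynomials. *)
Definition fps_trunc f (N : nat) : {poly F} := \poly_(i < N) f i.

Lemma coef_fps_trunc f N i : (i < N)%N -> (fps_trunc f N)`_i = f i.
Proof. by move=> iN; rewrite coef_poly iN. Qed.

Lemma fps_mul_trunc f g N n : (n < N)%N ->
  fps_mul f g n = (fps_trunc f N * fps_trunc g N)`_n.
Proof.
move=> nN; rewrite coefM; apply: eq_bigr => -[i /= ltin] _.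
by rewrite !coef_fps_trunc // (leq_ltn_trans _ nN) ?leq_subr.
Qed.

Let mul f g : fps F := fps_mul f g.
Let one : fps F := fps_one F.

Let mulC : commutative mul.
Proof.
move=> f g; apply/funext => n.
by rewrite /mul !(@fps_mul_trunc _ _ n.+1) // mulrC.
Qed.

Let mulA : associative mul.
Proof.
move=> f g h; apply/funext => n.
rewrite /mul (@fps_mul_trunc _ _ n.+1) // [RHS](@fps_mul_trunc _ _ n.+1) //.
have coefMl (p q r : {poly F}) : (forall i, (i < n.+1)%N -> p`_i = q`_i) ->
    (p * r)`_n = (q * r)`_n.
  by move=> pq; rewrite !coefM; apply: eq_bigr => -[i lti] _; rewrite pq.
rewrite mulrC [LHS](coefMl _ (fps_trunc g n.+1 * fps_trunc h n.+1)); last first.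
  by move=> i lti; rewrite coef_fps_trunc // -fps_mul_trunc.
rewrite mulrC mulrA; apply: coefMl => i lti.
by rewrite coef_fps_trunc // -fps_mul_trunc.
Qed.

Let mul1 : left_id one mul.
Proof.
move=> f; apply/funext => n; rewrite /mul /fps_mul big_ord_recl mul1r subn0.
by rewrite big1 ?addr0 // => i _; rewrite mul0r.
Qed.

Let mulDl : left_distributive mul +%R.
Proof.
move=> f g h; apply/funext => n; rewrite /mul /fps_mul.
rewrite -[RHS]/(\sum_(i < n.+1) f i * h (n - i)%N
               + \sum_(i < n.+1) g i * h (n - i)%N) -big_split.
by apply: eq_bigr => i _; rewrite mulrDl.
Qed.

Let one_neq0 : one != 0 :> fps F.
Proof. by apply/eqP => /(congr1 (fun f => f 0)) /eqP; rewrite oner_eq0. Qed.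

HB.instance Definition _ :=
  GRing.Zmodule_isComNzRing.Build (fps F) mulA mulC mul1 mulDl one_neq0.

Lemma fpsD f g n : (f + g) n = f n + g n. Proof. by []. Qed.
Lemma fpsN f n : (- f) n = - f n. Proof. by []. Qed.
Lemma fps1 n : (1 : fps F) n = (n == 0)%:R. Proof. by []. Qed.
Lemma fpsM f g n : (f * g) n = \sum_(i < n.+1) f i * g (n - i)%N.
Proof. by []. Qed.
Lemma fpsMn f m n : (f *+ m) n = f n *+ m.
Proof. by elim: m => // m IHm; rewrite !mulrS fpsD IHm. Qed.
Lemma fps_expE f m : fps_exp f m = f ^+ m.
Proof. by elim: m => // m IHm; rewrite exprS -IHm. Qed.

Definition fps_t : fps F := fun n => (n == 1)%:R.

Lemma fps_tM0 f : (fps_t * f) 0 = 0.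
Proof. by rewrite fpsM big_ord1 mul0r. Qed.

Lemma fps_tMS f n : (fps_t * f) n.+1 = f n.
Proof.
rewrite fpsM big_ord_recl mul0r add0r big_ord_recl mul1r /= subSS subn0.
by rewrite big1 ?addr0 // => i _; rewrite mul0r.
Qed.

(** The Euler derivation t d/dt, which keeps the index of each coefficient. *)
Definition fps_theta f : fps F := fun n => n%:R * f n.

Lemma fps_thetaM f g : fps_theta (f * g) = fps_theta f * g + f * fps_theta g.
Proof.
apply/funext => n; rewrite fpsD !fpsM -big_split /fps_theta /= mulr_sumr.
apply: eq_bigr => -[i /= lti] _.
have -> : n%:R = i%:R + (n - i)%:R :> F by rewrite -natrD subnKC.
by ring.
Qed.

Lemma fps_theta1 : fps_theta 1 = 0.
Proof. by apply/funext => -[|n]; rewrite /fps_theta ?mul0r ?fps1 ?mulr0. Qed.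

Lemma fps_thetaX f n : fps_theta (f ^+ n.+1) = (f ^+ n * fps_theta f) *+ n.+1.
Proof.
elim: n => [|n IHn]; first by rewrite expr1 expr0 mul1r.
rewrite exprS fps_thetaM IHn [in RHS]mulrS exprS mulrnAr; congr (_ + _).
  by rewrite mulrC.
by rewrite mulrA.
Qed.

Lemma coef_fpsX_trunc f k N n : (n < N)%N ->
  (f ^+ k) n = (fps_trunc f N ^+ k)`_n.
Proof.
elim: k n => [|k IHk] n nN; first by rewrite !expr0 coef1 fps1.
rewrite !exprS fpsM coefM; apply: eq_bigr => -[i /= lti] _.
have le m : (m <= n)%N -> (m < N)%N by move/leq_ltn_trans; apply.
by rewrite coef_fps_trunc ?IHk ?le ?leq_subr.
Qed.

(** The bound [N] is kept independent of [n]: the entries of a tuple of sum [n]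
    are at most [n], and any larger range only adds tuples that the filter
    discards. *)
Lemma fpsX_tuple f k N n : (n < N)%N ->
  (f ^+ k) n = \sum_(t : k.-tuple 'I_N | (\sum_(i < k) tnth t i == n)%N)
                 \prod_(i < k) f (tnth t i).
Proof.
move=> nN; rewrite (coef_fpsX_trunc _ _ nN).
rewrite -[X in _ ^+ X]card_ord -prodr_const /fps_trunc poly_def.
rewrite (bigA_distr_bigA (fun (i : 'I_k) (j : 'I_N) => f j *: 'X^j)) /=.
rewrite (reindex (fun t : k.-tuple 'I_N => [ffun i => tnth t i])) /=; last first.
  exists (fun h : {ffun 'I_k -> 'I_N} => [tuple h i | i < k]) => [t|h] _.
    by apply/eq_from_tnth => i; rewrite tnth_mktuple ffunE.
  by apply/ffunP => i; rewrite ffunE tnth_mktuple.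
rewrite coef_sum [RHS]big_mkcond; apply: eq_bigr => t _.
under eq_bigr do rewrite ffunE.
rewrite scaler_prod -expr_sum coefZ coefXn eq_sym.
by case: eqP => _; rewrite ?mulr1 ?mulr0.
Qed.

End FpsRing.

(** * The exponential series and t / (e^t - 1) *)

Section Exponential.
Variable F : numFieldType.
Implicit Types (c x y z : F) (f g h : fps F).

Local Notation E x := (fps_exponential x : fps F).
Local Notation t := (fps_t F).
Local Notation e := (fps_expm1_div F : fps F).
Local Notation g := (fps_inv e : fps F).

Lemma natf_neq0 n : n.+1%:R != 0 :> F.
Proof. by rewrite pnatr_eq0. Qed.

Lemma factf_neq0 n : n`!%:R != 0 :> F.
Proof. by rewrite pnatr_eq0 -lt0n fact_gt0. Qed.

Definition fps_const c : fps F := fun n => c * (n == 0)%:R.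

Lemma fps_constM c f n : (fps_const c * f) n = c * f n.
Proof.
rewrite fpsM big_ord_recl /fps_const mulr1 subn0.
by rewrite big1 ?addr0 // => i _; rewrite mulr0 mul0r.
Qed.

Lemma fps_exponentialD x y : E (x + y) = E x * E y.
Proof.
apply/funext => n; rewrite fpsM /fps_exponential addrC exprDn mulr_suml.
apply: eq_bigr => -[i /= lti] _; rewrite -(bin_fact (lti : (i <= n)%N)).
rewrite !natrM -[in LHS]mulr_natr.
have := factf_neq0 i; have := factf_neq0 (n - i).
have : 'C(n, i)%:R != 0 :> F by rewrite pnatr_eq0 -lt0n bin_gt0.
by move=> ? ? ?; field; apply/and3P.
Qed.

Lemma fps_t_expm1_div : t * e = E 1 - 1.
Proof.
apply/funext => -[|n]; last by rewrite fps_tMS.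
by rewrite fps_tM0 fpsD fpsN fps1 /fps_exponential expr0 divr1 subrr.
Qed.

Lemma fps_expm1_div_coef n : e n = n.+1`!%:R^-1.
Proof. by rewrite /fps_expm1_div /fps_exponential /fps_one subr0 expr1n mul1r. Qed.

Lemma fps_expm1_divV : e * g = 1.
Proof.
apply/funext => n; apply: fps_mulV.
by rewrite fps_expm1_div_coef invr_eq0 factf_neq0.
Qed.

Lemma fps_tI f h : t * f = t * h -> f = h.
Proof. by move=> fh; apply/funext => n; rewrite -fps_tMS fh fps_tMS. Qed.

Lemma fps_theta_t : fps_theta t = t.
Proof. by apply/funext => -[|[|n]]; rewrite /fps_theta /fps_t ?mulr0 ?mul1r. Qed.

Lemma fps_theta_exponential x : fps_theta (E x) = fps_const x * (t * E x).
Proof.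
apply/funext => -[|n]; rewrite fps_constM /fps_theta.
  by rewrite fps_tM0 mulr0 mul0r.
rewrite fps_tMS /fps_exponential factS natrM exprS.
by have := natf_neq0 n; have := factf_neq0 n => ? ?; field; apply/andP.
Qed.

Lemma fps_thetaB f h : fps_theta (f - h) = fps_theta f - fps_theta h.
Proof. by apply/funext => n; rewrite /fps_theta !fpsD !fpsN mulrBr. Qed.

(** Apply the derivation to t e = e^t - 1 and cancel t. *)
Lemma fps_theta_expm1_div : fps_theta e = t * e + 1 - e.
Proof.
apply: fps_tI; have := congr1 (@fps_theta F) fps_t_expm1_div.
rewrite fps_thetaM fps_theta_t (fps_thetaB (E 1)) (@fps_theta1 F) subr0.
have -> : fps_theta (E 1) = t * (t * e + 1).
  rewrite fps_theta_exponential fps_t_expm1_div subrK.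
  by apply/funext => n; rewrite fps_constM mul1r.
by move=> te; rewrite mulrBr -te; ring.
Qed.

(** Apply the derivation to e g = 1: the result is the Riccati equation of
    g = t / (e^t - 1). *)
Lemma fps_theta_inv_expm1_div : fps_theta g = g - t * g - g ^+ 2.
Proof.
have h := congr1 (@fps_theta F) fps_expm1_divV.
rewrite fps_thetaM (@fps_theta1 F) fps_theta_expm1_div in h.
transitivity (fps_theta g * (e * g)); first by rewrite fps_expm1_divV mulr1.
(* The first summand contains the derivative of e g, which vanishes. *)
transitivity (g * ((t * e + 1 - e) * g + e * fps_theta g)
              + (g * (e * g) - t * g * (e * g) - g ^+ 2)); first by ring.
by rewrite h fps_expm1_divV mulr0 add0r !mulr1.
Qed.

(** The general relation between the orders m and m + 1 reads
    t F' = m F - m t F - m g F + x t F for F = g^m e^(x t). In the coefficient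
    of t^m the left side equals m F_m and cancels the term m F, so that only
    one Bernoulli number of each order survives. This is why the diagonal,
    where order and index are tied together, has a product formula. *)
Lemma fps_exponential_diagonal x n :
  n.+1%:R * (g ^+ n.+2 * E x) n.+1 = (x - n.+1%:R) * (g ^+ n.+1 * E x) n.
Proof.
set m := n.+1.
have expand (A : comNzRingType) (G T X Ex : A) :
    (G ^+ n * (G - T * G - G ^+ 2)) *+ m * Ex + G ^+ m * (X * (T * Ex)) =
    (G ^+ m * Ex) *+ m - (T * (G ^+ m * Ex)) *+ m - (G ^+ m.+1 * Ex) *+ m
    + X * (T * (G ^+ m * Ex)).
  by rewrite /m !exprS; ring.
have key : fps_theta (g ^+ m * E x) =
    (g ^+ m * E x) *+ m - (t * (g ^+ m * E x)) *+ m - (g ^+ m.+1 * E x) *+ m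
    + fps_const x * (t * (g ^+ m * E x)).
  rewrite fps_thetaM fps_theta_exponential fps_thetaX fps_theta_inv_expm1_div.
  exact: expand.
have := congr1 (fun f : fps F => f m) key.
rewrite /fps_theta !fpsD !fpsN !fpsMn fps_constM fps_tMS.
move/eqP; rewrite eq_sym -subr_eq0 => /eqP key'.
apply/eqP; rewrite -subr_eq0 -oppr_eq0 -key'; apply/eqP; ring.
Qed.

(** The theorem for zero integrations: B_n^(n+1)(1 + z) = (z)_n. *)
Lemma falling_fps z n : falling z n = n`!%:R * (g ^+ n.+1 * E (1 + z)) n.
Proof.
elim: n => [|n IHn].
  rewrite /falling big_ord0 expr1 fpsM big_ord1 subn0 mul1r.
  rewrite /fps_exponential expr0 divr1 mulr1 /fps_inv /=.
  by rewrite fps_expm1_div_coef invr1 invr1.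
rewrite /falling big_ord_recr /= -/(falling z n) IHn factS mulnC natrM -mulrA.
rewrite fps_exponential_diagonal -mulrA; congr (_ * _); rewrite mulrC.
congr (_ * _).
by rewrite -natr1; ring.
Qed.

Lemma falling_fps_stirling1 z n :
  falling z n = \sum_(l < n.+1) ((stirling1 n l)%:~R * l`!%:R) * (E z) l.
Proof.
rewrite falling_stirling1; apply: eq_bigr => l _.
rewrite /fps_exponential -mulrA; congr (_ * _).
by rewrite mulrCA divff ?mulr1 ?factf_neq0.
Qed.

Lemma eq_fps_expm1_div f : f * g = 1 -> f = e.
Proof. by move=> fg; rewrite -[f]mulr1 -fps_expm1_divV mulrCA fg mulr1. Qed.

Lemma fps_inv_inv : fps_inv g = e.
Proof.
apply: eq_fps_expm1_div; rewrite mulrC; apply/funext => n; apply: fps_mulV.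
apply/eqP => g0; have := congr1 (fun f : fps F => f 0) fps_expm1_divV.
by rewrite fpsM big_ord1 g0 mulr0 => /eqP; rewrite eq_sym oner_eq0.
Qed.

Lemma fps_expz_sub n k : fps_expz g (n%:Z - k%:Z) = g ^+ n * e ^+ k :> fps F.
Proof.
have expVK m : g ^+ m * e ^+ m = 1.
  by rewrite -exprMn mulrC fps_expm1_divV expr1n.
have [kn|nk] := leqP k n.
  rewrite -{2}(subnK kn) exprD -mulrA expVK mulr1 -fps_expE.
  by rewrite subzn.
have [m ->] : exists m, k = (n + m.+1)%N.
  by exists (k - n).-1; rewrite prednK ?subnKC ?subn_gt0 // ltnW.
rewrite PoszD opprD addrA subrr add0r -NegzE.
transitivity (fps_exp (fps_inv g) m.+1 : fps F); first by [].
by rewrite fps_expE fps_inv_inv exprD mulrA expVK mul1r.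
Qed.

(** The order n - k + 1 is split into the factor g^(n+1) of the case k = 0 and
    the factor e^k that k integrations create. *)
Lemma bernoulli_fps n k x :
  bernoulli (n%:Z - k%:Z + 1) n (1 + x) =
  n`!%:R * (g ^+ n.+1 * E 1 * e ^+ k * E x) n.
Proof.
rewrite /bernoulli -[fps_mul _ _ _]/((_ * _ : fps F) n).
have -> : n%:Z - k%:Z + 1 = n.+1%:Z - k%:Z by rewrite intS; ring.
rewrite fps_expz_sub fps_exponentialD; congr (_ * _).
by congr ((_ : fps F) n); ring.
Qed.

(** The n-th coefficient of f(t) e^(y t) as a polynomial in y. These form an
    Appell sequence, hence antiderivatives are shifts of the index. *)
Definition fps_appell f n : {poly F} :=
  \sum_(i < n.+1) (f i / (n - i)`!%:R) *: 'X^(n - i).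

Lemma horner_fps_appell f n y : (fps_appell f n).[y] = (f * E y) n.
Proof.
rewrite horner_sum fpsM; apply: eq_bigr => i _.
by rewrite hornerZ hornerXn /fps_exponential; ring.
Qed.

Lemma deriv_fps_appell f n : (fps_appell f n.+1)^`() = fps_appell f n.
Proof.
rewrite /fps_appell big_ord_recr /= subnn expr0 derivD derivZ.
rewrite derivC scaler0 addr0 (raddf_sum (@deriv _)).
apply: eq_bigr => -[i /= lti] _.
rewrite derivZ derivXn subSn //= -scaler_nat scalerA factS natrM.
congr (_ *: _).
have := natf_neq0 (n - i); have := factf_neq0 (n - i) => ? ?.
by field; apply/andP.
Qed.

(** The integral over [y, y + 1] of the n-th polynomial: integrating e^(y t) in y
    multiplies the series by (e^t - 1) / t. *)
Lemma sub_fps_appell f n y :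
  (fps_appell f n.+1).[y + 1] - (fps_appell f n.+1).[y] = (f * e * E y) n.
Proof.
have shift : t * (f * e * E y) = f * E (y + 1) - f * E y.
  transitivity (f * (t * e) * E y); first by ring.
  by rewrite fps_t_expm1_div fps_exponentialD; ring.
by rewrite !horner_fps_appell -[RHS]fps_tMS shift.
Qed.

End Exponential.

(** * Integrals of complex polynomials over the unit interval *)

Import numFieldNormedType.Exports.
Section Integral.
Variable R : realType.

Lemma Rintegral_deriv_poly (p : {poly R}) :
  \int[lebesgue_measure]_(t in `[0, 1]%classic) p^`().[t] = p.[1] - p.[0].
Proof.
rewrite /Rintegral (@continuous_FTC2 _ _ (horner p)) //.
- by apply: continuous_subspaceT => x; exact: continuous_horner.
- split=> [x _||].
  + exact: derivable_horner.
  + by apply: cvg_at_right_filter; exact: continuous_horner.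
  + by apply: cvg_at_left_filter; exact: continuous_horner.
- by move=> x _; rewrite derivE.
Qed.

(** [L] stands for the real or the imaginary part, so that both parts of a
    complex integral are treated at once. *)
Section Additive.
Variable L : {additive Rcomplex R -> R}.
Hypothesis LZ : forall (z : R[i]) (a : R), L (z * a%:C%C) = L z * a.

Definition poly_additive (p : {poly R[i]}) : {poly R} :=
  \poly_(i < size p) L p`_i.

Lemma coef_poly_additive p i : (poly_additive p)`_i = L p`_i.
Proof.
by rewrite coef_poly; case: ltnP => // lepi; rewrite nth_default ?raddf0.
Qed.

Lemma horner_poly_additive p a : (poly_additive p).[a] = L p.[a%:C%C].
Proof.
rewrite /poly_additive horner_poly horner_coef raddf_sum.
by apply: eq_bigr => i _; rewrite -rmorphXn /= LZ.
Qed.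

Lemma deriv_poly_additive p : (poly_additive p)^`() = poly_additive p^`().
Proof.
apply/polyP => i; rewrite coef_deriv !coef_poly_additive.
by rewrite [in RHS]coef_deriv (raddfMn L).
Qed.

End Additive.

End Integral.

Section ComplexIntegral.
Variable R : realType.
Local Notation C := R[i].

Lemma integral01_deriv_poly (p : {poly C}) (y : C) :
  integral01 (fun t : R => p^`().[y + t%:C%C]) = p.[y + 1] - p.[y].
Proof.
(* The base point is moved to 0 because L commutes only with real scalars. *)
pose q := p \Po ('X + y%:P).
have qE (t : C) : q.[t] = p.[y + t] by rewrite horner_comp !hornerE addrC.
have dqE (t : C) : q^`().[t] = p^`().[y + t].
  rewrite deriv_comp derivD derivX derivC addr0 mulr1.
  by rewrite horner_comp !hornerE addrC.
have LE (L : {additive Rcomplex R -> R}) :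
    (forall (z : C) (a : R), L (z * a%:C%C) = L z * a) ->
    \int[lebesgue_measure]_(t in `[0, 1]%classic) L p^`().[y + t%:C%C] =
    L (p.[y + 1] - p.[y]).
  move=> LZ; under eq_Rintegral do
    rewrite -dqE -horner_poly_additive // -deriv_poly_additive.
  rewrite Rintegral_deriv_poly raddfB !horner_poly_additive // !qE.
  by rewrite addr0.
rewrite /integral01.
have -> := LE (@complex.Re R); last by move=> [u v] a /=; rewrite mulr0 subr0.
have -> := LE (@complex.Im R); last by move=> [u v] a /=; rewrite mulr0 add0r.
by case: (_ - _).
Qed.

End ComplexIntegral.

(** * Cauchy polynomials as coefficients of power series *)

Section CauchyIntegral.
Variable R : realType.
Local Notation C := R[i].
Local Notation E x := (fps_exponential x : fps C).
Local Notation e := (fps_expm1_div C : fps C).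
Local Notation g := (fps_inv e : fps C).

Lemma integral01_fps_exponential N (a : nat -> C) (h : fps C) (y : C) :
  integral01 (fun t : R => \sum_(l < N) a l * (h * E (y + t%:C%C)) l) =
  \sum_(l < N) a l * (h * e * E y) l.
Proof.
pose p := \sum_(l < N) a l *: fps_appell h l.+1.
have -> : (fun t : R => \sum_(l < N) a l * (h * E (y + t%:C%C)) l) =
    fun t : R => p^`().[y + t%:C%C].
  apply/funext => t; rewrite (raddf_sum (@deriv _)) horner_sum /=.
  apply: eq_bigr => l _.
  by rewrite derivZ deriv_fps_appell hornerZ horner_fps_appell.
rewrite integral01_deriv_poly !horner_sum -sumrB; apply: eq_bigr => l _.
by rewrite !hornerZ -mulrBr sub_fps_appell.
Qed.

(** A linear combination of the coefficients of h(t) e^(z t), and not a single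
    one, so that both expansions of the falling factorial are covered. *)
Lemma iter_integral01_fps_exponential k N (a : nat -> C) (h : fps C) (y : C) :
  iter_integral01 k (fun s : seq R =>
    \sum_(l < N) a l * (h * E (y + (\sum_(t <- s) t)%:C%C)) l) =
  \sum_(l < N) a l * (h * e ^+ k * E y) l.
Proof.
elim: k y => [|k IHk] y /=; first by rewrite big_nil addr0 mulr1.
under eq_fun => t.
  under eq_fun do rewrite big_cons rmorphD addrA.
  rewrite IHk; over.
by rewrite integral01_fps_exponential exprSr mulrA.
Qed.

(** Both sides are the integral of (x_1 + ... + x_k)^j over the unit cube. *)
Lemma fpsX_expm1_div_tuple k j : j`!%:R * (e ^+ k) j =
  \sum_(t : k.-tuple 'I_j.+1 | (\sum_(i < k) tnth t i == j)%N)
    multinomial C t / \prod_(i < k) ((tnth t i).+1)%:R.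
Proof.
rewrite (fpsX_tuple e k (ltnSn j)) mulr_sumr; apply: eq_bigr => t _.
rewrite /multinomial -mulrA -!prodfV -big_split; congr (_ * _).
apply: eq_bigr => i _ /=.
by rewrite fps_expm1_div_coef factS natrM invfM mulrC.
Qed.

End CauchyIntegral.

Theorem theorem2p4 (R : realType) (n k : nat) (x : R[i]) (hk : (1 <= k)%N) :
  cauchy_poly k n x = bernoulli (n%:Z - k%:Z + 1) n (1 - x) /\
  bernoulli (n%:Z - k%:Z + 1) n (1 - x) =
    \sum_(l < n.+1) \sum_(j < l.+1)
      \sum_(t : k.-tuple 'I_j.+1 | (\sum_(i < k) tnth t i == j)%N)
        multinomial R[i] t * 'C(l, j)%:R * (stirling1 n l)%:~R *
        ((- x) ^+ (l - j) / \prod_(i < k) ((tnth t i).+1)%:R).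
Proof.
set e : fps R[i] := fps_expm1_div R[i].
set g : fps R[i] := fps_inv e.
pose E x : fps R[i] := fps_exponential x.
have cauchyB : cauchy_poly k n x = bernoulli (n%:Z - k%:Z + 1) n (1 - x).
  rewrite bernoulli_fps -/e -/g -!/(E _).
  (* Weights selecting the n-th coefficient alone. *)
  pose a l : R[i] := n`!%:R * (l == n)%:R.
  have aE (f : fps R[i]) : \sum_(l < n.+1) a l * f l = n`!%:R * f n.
    rewrite big_ord_recr /= /a eqxx mulr1 big1 ?add0r // => -[l /= ltl] _.
    by rewrite (ltn_eqF ltl) mulr0 mul0r.
  rewrite -aE -iter_integral01_fps_exponential; congr iter_integral01.
  apply/funext => s; rewrite falling_fps -aE; apply: eq_bigr => l _.
  by rewrite fps_exponentialD mulrA [_ - x]addrC.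
split=> //; rewrite -cauchyB.
pose a l : R[i] := (stirling1 n l)%:~R * l`!%:R.
(* Here the falling factorial comes from e^(z t) itself, with h = 1. *)
transitivity (\sum_(l < n.+1) a l * (1 * e ^+ k * E (- x)) l).
  rewrite -iter_integral01_fps_exponential; congr iter_integral01.
  apply/funext => s; rewrite falling_fps_stirling1; apply: eq_bigr => l _.
  by rewrite mul1r addrC.
apply: eq_bigr => l _; rewrite mul1r fpsM mulr_sumr.
apply: eq_bigr => -[j /= ltj] _.
transitivity ((stirling1 n l)%:~R * 'C(l, j)%:R * (- x) ^+ (l - j) *
   (j`!%:R * (e ^+ k) j)).
  rewrite /a /E /fps_exponential -(bin_fact (ltj : (j <= l)%N)) !natrM.
  by have := factf_neq0 R[i] (l - j) => ?; field.
rewrite fpsX_expm1_div_tuple mulr_sumr; apply: eq_bigr => t _.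
by ring.
Qed.
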